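(* Let $N$ be a closed normal subgroup of a topological group $G$. Let $q:G\to G/N$ be the quotient homomorphism, and let $\widehat q:\rho G\to\rho(G/N)$ be its (unique) continuous homomorphic extension to the Raikov completions. Then $$r_\rho(G/N)=\widehat q\bigl(r_\rho(G)\bigr)$$ if and only if $\widehat q$ is onto and $\widehat q^{-1}(G/N)=G$. Under these two conditions ($\widehat q$ onto and $\widehat q^{-1}(G/N)=G$), pseudocompactness of $r_\rho(G)$ implies pseudocompactness of $r_\rho(G/N)$.
   Context: All topological groups are assumed Hausdorff. For a topological group $G$, $\rho G$ denotes its Raikov completion, i.e. the completion with respect to the two-sided group uniformity; $G$ is regarded as a dense topological subgroup of $\rho G$. The Raikov remainder of $G$ is the subspace $r_\rho(G)=\rho G\setminus G$ of $\rho G$. Every continuous homomorphism $f:G\to K$ of topological groups extends uniquely to a continuous homomorphism $\widehat f:\rho G\to\rho K$. The group $G/N$ carries the quotient topology. A Tychonoff space is pseudocompact if every continuous real-valued function on it is bounded; the empty space is regarded as pseudocompact. *)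

(* Defs.v *)
From HB Require Import structures.
From mathcomp Require Import all_boot all_order all_algebra.
From mathcomp Require Import all_classical all_reals all_analysis.
Import numFieldNormedType.Exports.

Set Implicit Arguments.
Unset Strict Implicit.
Unset Printing Implicit Defensive.

Local Open Scope classical_set_scope.
Local Open Scope group_scope.
Local Open Scope quotient_scope.

HB.mixin Record isTopologicalGroup G & Group G & Topological G := {
  mulg_continuous : continuous (fun xy : G * G => xy.1 * xy.2) ;
  invg_continuous : continuous (fun x : G => x^-1)
}.

(* Not assumed Hausdorff: separation is a separate hypothesis. *)
#[short(type="topologicalGroupType")]
HB.structure Definition TopologicalGroup :=
  {G of Group G & Topological G & isTopologicalGroup G}.

Section topological_group_theory.
Context {G : topologicalGroupType}.
Implicit Types (x y : G) (U : set G).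

Lemma mulg_cvg x y : (fun xy : G * G => xy.1 * xy.2) @ (x, y) --> x * y.
Proof. exact: (@mulg_continuous G (x, y)). Qed.

Lemma mulgl_continuous x : continuous (fun y => x * y).
Proof.
move=> y; apply: (cvg_comp2 (cvg_cst x) cvg_id (@mulg_cvg x y)).
Qed.

Lemma mulgr_continuous x : continuous (fun y => y * x).
Proof.
move=> y; apply: (cvg_comp2 cvg_id (cvg_cst x) (@mulg_cvg y x)).
Qed.

Lemma nbhs1_split U : nbhs (1 : G) U ->
  exists2 V, nbhs (1 : G) V & forall x y, V x -> V y -> U (x * y).
Proof.
move=> U1; have := @mulg_cvg 1 1 U; rewrite mulg1 => /(_ U1) [[A B] [/= A1 B1] AB].
exists (A `&` B); first exact: filterI.
by move=> x y [Ax _] [_ By]; apply: (AB (x, y)).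
Qed.

End topological_group_theory.

(* The two-sided group uniformity, carried by an alias of G. *)
Definition two_sided (G : Type) : Type := G.

Section two_sided_uniformity.
Context (G : topologicalGroupType).

HB.instance Definition _ := Topological.copy (two_sided G) G.

Definition two_sided_basic (U : set G) : set (two_sided G * two_sided G) :=
  [set xy | U ((xy.1 : G)^-1 * xy.2) /\ U ((xy.1 : G) * (xy.2 : G)^-1)].

Definition two_sided_ent : set_system (two_sided G * two_sided G) :=
  filter_from (nbhs (1 : G)) two_sided_basic.

Let ent_filter : Filter two_sided_ent.
Proof.
apply: filter_from_filter; first by exists setT; exact: filterT.
move=> U V U1 V1; exists (U `&` V); first exact: filterI.
by move=> xy [[? ?] [? ?]].
Qed.

Let ent_refl A : two_sided_ent A -> diagonal `<=` A.
Proof.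
move=> [U U1 UA] [x y]; rewrite /diagonal /= => <-; apply: UA.
rewrite /two_sided_basic /= mulVg mulgV; split; exact: nbhs_singleton.
Qed.

Let ent_inv A : two_sided_ent A -> two_sided_ent (A^-1)%relation.
Proof.
move=> [U U1 UA]; exists ((fun x : G => x^-1) @^-1` U).
  by apply: (@invg_continuous G 1); rewrite invg1.
move=> [x y] [/= Ul Ur]; apply: UA; split => /=.
  by move: Ul; rewrite invgM invgK.
by move: Ur; rewrite invgM invgK.
Qed.

Let ent_split A : two_sided_ent A ->
  exists2 B, two_sided_ent B & (B \; B `<=` A)%relation.
Proof.
move=> [U U1 UA]; have [V V1 VU] := nbhs1_split U1.
exists (two_sided_basic V); first by exists V.
move=> [x z] [y [/= xyl xyr] [/= yzl yzr]]; apply: UA; split => /=.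
  by have := VU _ _ xyl yzl; rewrite mulgA mulgK.
by have := VU _ _ xyr yzr; rewrite mulgA mulgVK.
Qed.

Let nbhs_ent : nbhs = nbhs_ two_sided_ent.
Proof.
apply/funext => x; apply/seteqP; split => A.
  move=> xA.
  have A1 : nbhs (1 : G) ((fun y => (x : G) * y) @^-1` A).
    by apply: (@mulgl_continuous G x 1); rewrite mulg1.
  exists (two_sided_basic ((fun y => (x : G) * y) @^-1` A)).
    by exists ((fun y => (x : G) * y) @^-1` A).
  by move=> y /xsectionP[/= + _]; rewrite mulgA mulgV mul1g.
move=> [B [U U1 UB] BA].
have Ul : nbhs (x : G) ((fun y => (x : G)^-1 * y) @^-1` U).
  by apply: mulgl_continuous; rewrite mulVg.
have Ur : nbhs (x : G) ((fun y => (x : G) * y^-1) @^-1` U).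
  have c : continuous ((fun y => (x : G) * y) \o (fun y : G => y^-1)).
    move=> z; apply: continuous_comp; first exact: invg_continuous.
    exact: mulgl_continuous.
  by apply: c; rewrite /= mulgV.
apply: filterS (filterI Ul Ur) => y [yl yr].
by apply/BA/xsectionP/UB.
Qed.

HB.instance Definition _ := Nbhs_isUniform_mixin.Build (two_sided G)
  ent_filter ent_refl ent_inv ent_split nbhs_ent.

End two_sided_uniformity.

Definition raikov_complete (G : topologicalGroupType) :=
  forall F : set_system (two_sided G),
    ProperFilter F -> cauchy F -> exists x : two_sided G, F --> x.

(* Raikov completions are unique up to topological isomorphism over G; an
   object of this type is any one of them, with the embedding of G. *)
Record raikovCompletion (G : topologicalGroupType) := RaikovCompletion {
  raikov_group :> topologicalGroupType ;
  raikov_hausdorff : hausdorff_space raikov_group ;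
  raikov_is_complete : raikov_complete raikov_group ;
  raikov_embed : {multiplicative G -> raikov_group} ;
  raikov_embed_inj : injective raikov_embed ;
  (* the topology of G is the one induced by the embedding *)
  raikov_embed_open : forall U : set G,
    open U <-> exists2 V, open V & raikov_embed @^-1` V = U ;
  raikov_embed_dense : dense (range raikov_embed)
}.

Arguments raikov_embed {G} r.

Definition raikov_remainder (G : topologicalGroupType)
    (rG : raikovCompletion G) : set rG := ~` range (raikov_embed rG).

Arguments raikov_remainder {G} rG.

Record normalSubgroup (G : groupType) := NormalSubgroup {
  normal_set :> set G ;
  normal1 : normal_set 1 ;
  normalM : forall x y, normal_set x -> normal_set y -> normal_set (x * y) ;
  normalV : forall x, normal_set x -> normal_set x^-1 ;
  normalJ : forall x y, normal_set x -> normal_set (x ^ y)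
}.

Section quotient_group.
Context {G : topologicalGroupType} (N : normalSubgroup G).

Definition coset_rel : rel G := fun x y => `[< normal_set N (x^-1 * y) >].

Let coset_rel_equiv : equiv_class_of coset_rel.
Proof.
split.
- by move=> x; apply/asboolP; rewrite mulVg; exact: normal1.
- move=> x y; apply/asbool_equiv_eq; split => /(@normalV _ N);
    by rewrite invgM invgK.
- move=> y x z /asboolP xy /asboolP yz; apply/asboolP.
  by have := normalM xy yz; rewrite mulgA mulgK.
Qed.

Canonical coset_equiv := EquivRelPack coset_rel_equiv.

Definition quotient_group : Type := quotient_topology {eq_quot coset_equiv}.

HB.instance Definition _ := Quotient.on quotient_group.
HB.instance Definition _ := Topological.on quotient_group.

Definition quotient_hom (x : G) : quotient_group := \pi_quotient_group x.

Lemma quotient_homP x y : quotient_hom x = quotient_hom y <-> normal_set N (x^-1 * y).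
Proof.
split => [/eqmodP /asboolP //|h]; by apply/eqmodP/asboolP.
Qed.

Lemma quotient_hom_surj (X : quotient_group) : exists x, quotient_hom x = X.
Proof. by exists (repr X); rewrite /quotient_hom reprK. Qed.

Definition quotient_one : quotient_group := quotient_hom 1.
Definition quotient_mul (X Y : quotient_group) : quotient_group :=
  quotient_hom (repr X * repr Y).
Definition quotient_inv (X : quotient_group) : quotient_group :=
  quotient_hom (repr X)^-1.

Lemma quotient_homM x y :
  quotient_hom (x * y) = quotient_mul (quotient_hom x) (quotient_hom y).
Proof.
apply/quotient_homP.
have /quotient_homP xN : quotient_hom x = quotient_hom (repr (quotient_hom x)).
  by rewrite /quotient_hom reprK.
have /quotient_homP yN : quotient_hom y = quotient_hom (repr (quotient_hom y)).
  by rewrite /quotient_hom reprK.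
move: (repr _) (repr _) xN yN => x' y' xN yN.
have := normalM (normalJ y xN) yN.
by rewrite /conjg !mulgA !invgM mulgK.
Qed.

Lemma quotient_homV x : quotient_hom x^-1 = quotient_inv (quotient_hom x).
Proof.
apply/quotient_homP.
have /quotient_homP xN : quotient_hom x = quotient_hom (repr (quotient_hom x)).
  by rewrite /quotient_hom reprK.
move: (repr _) xN => x' xN.
have := normalJ x^-1 (normalV xN).
by rewrite /conjg invgM !invgK !mulgA mulgK.
Qed.

Let quotient_mulA : associative quotient_mul.
Proof.
move=> X Y Z; have [x <-] := quotient_hom_surj X.
have [y <-] := quotient_hom_surj Y; have [z <-] := quotient_hom_surj Z.
by rewrite -!quotient_homM mulgA.
Qed.

Let quotient_mul1 : left_id quotient_one quotient_mul.
Proof.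
by move=> X; have [x <-] := quotient_hom_surj X; rewrite -quotient_homM mul1g.
Qed.

Let quotient_1mul : right_id quotient_one quotient_mul.
Proof.
by move=> X; have [x <-] := quotient_hom_surj X; rewrite -quotient_homM mulg1.
Qed.

Let quotient_mulV : left_inverse quotient_one quotient_inv quotient_mul.
Proof.
move=> X; have [x <-] := quotient_hom_surj X.
by rewrite -quotient_homV -quotient_homM mulVg.
Qed.

Let quotient_Vmul : right_inverse quotient_one quotient_inv quotient_mul.
Proof.
move=> X; have [x <-] := quotient_hom_surj X.
by rewrite -quotient_homV -quotient_homM mulgV.
Qed.

HB.instance Definition _ := isGroup.Build quotient_group
  quotient_mulA quotient_mul1 quotient_1mul quotient_mulV quotient_Vmul.

HB.instance Definition _ := isMultiplicative.Build G quotient_group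
  quotient_hom quotient_homM.

Lemma quotient_hom_continuous : continuous quotient_hom.
Proof. exact: pi_continuous. Qed.

Lemma quotient_openP (A : set quotient_group) :
  open A <-> open (quotient_hom @^-1` A).
Proof. by []. Qed.

Lemma quotient_hom_open (U : set G) : open U -> open (quotient_hom @` U).
Proof.
move=> oU; apply/quotient_openP.
rewrite (_ : _ @^-1` _ = \bigcup_(n in normal_set N) ((fun x => x * n) @^-1` U)).
  apply: bigcup_open => n _.
  by apply: open_comp => // x _; exact: mulgr_continuous.
apply/seteqP; split => x /=.
  move=> [u Uu /esym/quotient_homP xu]; exists (x^-1 * u) => //=.
  by rewrite mulgA mulgV mul1g.
move=> [n Nn /= Uxn]; exists (x * n) => //.
by apply/esym/quotient_homP; rewrite mulgA mulVg mul1g.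
Qed.

Lemma quotient_hom_nbhs x (U : set G) :
  nbhs x U -> nbhs (quotient_hom x) (quotient_hom @` U).
Proof.
rewrite nbhsE => -[V [oV Vx] VU]; apply: (@filterS _ _ _ (quotient_hom @` V)).
  exact: image_subset.
by apply: open_nbhs_nbhs; split; [exact: quotient_hom_open|exists x].
Qed.

Let quotient_mul_continuous : continuous
  (fun XY : quotient_group * quotient_group => XY.1 * XY.2).
Proof.
move=> [X Y]; have [x <-] := quotient_hom_surj X.
have [y <-] := quotient_hom_surj Y => W /=; rewrite -gmulfM => nW.
have := quotient_hom_continuous nW => /(@mulg_cvg G x y).
move=> [[A B] [/= xA yB] AB].
exists (quotient_hom @` A, quotient_hom @` B).
  by split; exact: quotient_hom_nbhs.
move=> [_ _] [/= [a Aa <-] [b Bb <-]]; rewrite -gmulfM.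
exact: (AB (a, b)).
Qed.

Let quotient_inv_continuous : continuous (fun X : quotient_group => X^-1).
Proof.
apply/(@quotient_continuous G {eq_quot coset_equiv}) => x.
rewrite (_ : _ \o _ = quotient_hom \o (fun x : G => x^-1)); last first.
  by apply/funext => z /=; rewrite -[RHS]/(quotient_hom z^-1) quotient_homV.
by apply: continuous_comp; [exact: invg_continuous|exact: quotient_hom_continuous].
Qed.

HB.instance Definition _ := isTopologicalGroup.Build quotient_group
  quotient_mul_continuous quotient_inv_continuous.

End quotient_group.

(* Real functions on the subspace A are represented by total functions whose
   restriction to A is continuous, the values outside of A being irrelevant. *)
Definition pseudocompact (R : realType) (T : topologicalType) (A : set T) :=
  forall f : T -> R, {within A, continuous f} ->
    exists M : R, forall x, A x -> (`|f x| <= M)%R.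

(* Main.v *)
Require Import Defs.
From mathcomp Require Import all_boot all_order all_algebra.
From mathcomp Require Import all_classical all_reals all_analysis.
Import numFieldNormedType.Exports.

(** Two observations suffice.

    The first is set-theoretic.  Let a map [q] send a subset [A] of its domain
    onto a subset [B] of its codomain.  Then [q] sends the complement of [A]
    onto the complement of [B] exactly when [q] is onto and no point outside
    [A] falls into [B] ([image_setC_eqP]).  Here [A] is [G], [B] is [G/N] and
    [q] is the extension of the quotient homomorphism, which sends [G] onto
    [G/N] because it extends a surjection.

    The second is topological.  Under these conditions the remainder of [G/N]
    is a continuous image of the remainder of [G], and pseudocompactness
    passes to continuous images because a continuous function on the image,
    pulled back to the source, has the same values ([pseudocompact_image]). *)

Local Open Scope classical_set_scope.

(** Both sides amount to two things: [q] maps no point outside [A] into [B],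
    and it reaches every point outside [B].  The points of [B] are reached from
    [A], and a preimage of a point outside [B] cannot lie in [A]. *)
Lemma image_setC_eqP (X Y : Type) (q : X -> Y) (A : set X) (B : set Y) :
  q @` A = B ->
  ~` B = q @` (~` A) <-> range q = setT /\ q @^-1` B = A.
Proof.
move=> qAB; split=> [qC|[qT qB]].
  split.
    apply/seteqP; split=> // y _.
    have [|] := pselect (B y).
      by rewrite -qAB => -[x _ <-]; exists x.
    by move=> nBy; have : (~` B) y by []; rewrite qC => -[x _ <-]; exists x.
  apply/seteqP; split=> x /=; last by move=> Ax; rewrite -qAB; exists x.
  move=> Bqx; apply: contrapT => nAx.
  have : (~` B) (q x) by rewrite qC; exists x.
  exact.
rewrite -qB; apply/seteqP; split=> [y nBy|_ [x nBqx <-] //].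
by have : range q y; [rewrite qT|move=> [x _ qxy]; exists x; rewrite //= qxy].
Qed.

Lemma pseudocompact_image (R : realType) (X Y : topologicalType) (q : X -> Y)
    (A : set X) :
  {within A, continuous q} -> pseudocompact R A -> pseudocompact R (q @` A).
Proof.
move=> /subspace_continuousP cq pA f /subspace_continuousP cf.
have [|M fqM] := pA (f \o q); last by exists M => _ [x Ax <-]; exact: fqM.
apply/subspace_continuousP => x Ax W fqxW.
have qxA : (q @` A) (q x) by exists x.
(* [f] is controlled near [q x] along [q @` A] only, which is enough because
   [q] sends the nearby points of [A] into that set *)
have := cq x Ax _ (cf _ qxA _ fqxW).
by apply: (@filterS _ (nbhs x)) => z fqzW Az; apply: fqzW => //; exists z.
Qed.

Theorem proposition3p9 (R : realType) (G : topologicalGroupType)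
    (hG : hausdorff_space G) (N : normalSubgroup G)
    (hN : closed (N : set G))
    (rG : raikovCompletion G) (rQ : raikovCompletion (quotient_group N))
    (qhat : {multiplicative rG -> rQ}) (qhat_continuous : continuous qhat)
    (qhat_extends : forall x : G,
      qhat (raikov_embed rG x) = raikov_embed rQ (quotient_hom N x)) :
  (raikov_remainder rQ = qhat @` raikov_remainder rG <->
   range qhat = setT /\
   qhat @^-1` range (raikov_embed rQ) = range (raikov_embed rG)) /\
  (range qhat = setT ->
   qhat @^-1` range (raikov_embed rQ) = range (raikov_embed rG) ->
   pseudocompact R (raikov_remainder rG) ->
   pseudocompact R (raikov_remainder rQ)).
Proof.
have qG : qhat @` range (raikov_embed rG) = range (raikov_embed rQ).
  apply/seteqP; split=> [_ [_ [x _ <-] <-]|_ [X _ <-]].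
    by rewrite qhat_extends; exists (quotient_hom N x).
  have [x <-] := quotient_hom_surj X.
  by exists (raikov_embed rG x); [exists x|exact: qhat_extends].
have remainderP := image_setC_eqP _ _ _ _ _ qG.
split=> // qT qB prG.
rewrite /raikov_remainder (remainderP.2 (conj qT qB)).
by apply: pseudocompact_image prG; exact: continuous_subspaceT.
Qed.
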